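(* Let $X$ and $Y$ be two real Banach spaces and let $\kappa$ be an uncountable cardinal. Let $H$ be a linear subspace of $L(Y,X)$ containing $F(Y,X)$. Then: (1) If $H$ is $\kappa$-octahedral and $Y$ is uniformly convex, then for every subspace $Z\subseteq X$ with $\operatorname{dens}(Z)<\kappa$, every subspace $W\subseteq Y$ with $\operatorname{dens}(W)<\kappa$ and every $\varepsilon>0$ there exists $\phi\in B_{L(Y,X)}$ such that $$\Vert z+\phi(w)\Vert\geq (1-\varepsilon)(\Vert z\Vert+\Vert w\Vert)$$ holds for every $z\in Z$ and every $w\in W$. In particular, when $\varepsilon<1$, $\phi_{|W}$ is a $\frac{1}{1-\varepsilon}$-isometry, that is, $(1-\varepsilon)\Vert w\Vert\leq \Vert \phi(w)\Vert\leq \frac{1}{1-\varepsilon}\Vert w\Vert$ for every $w\in W$. (2) If $H$ is $\kappa$-rigid octahedral and every $y\in S_Y$ is a strongly exposed point of $B_Y$ (which happens in particular if $Y$ is locally uniformly rotund), then for every subspace $Z\subseteq X$ with $\operatorname{dens}(Z)<\kappa$ and every subspace $W\subseteq Y$ with $\operatorname{dens}(W)<\kappa$ there exists $\phi\in B_{L(Y,X)}$ such that $$\Vert z+\phi(w)\Vert=\Vert z\Vert+\Vert w\Vert$$ holds for every $z\in Z$ and every $w\in W$. In particular $\phi_{|W}$ is an isometry into $X$.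
   Context: $L(Y,X)$ is the space of bounded linear operators from $Y$ to $X$ with the operator norm, and $F(Y,X)$ its subspace of finite-rank bounded operators. $B_E$ and $S_E$ denote the closed unit ball and unit sphere of a normed space $E$. $\operatorname{dens}(E)$ is the least cardinality of a subset of $E$ whose linear span is dense in $E$ (so $\operatorname{dens}(E)=\dim E$ if $E$ is finite-dimensional). For an infinite cardinal $\kappa$, a normed space $E$ is $\kappa$-octahedral if for every cardinal $\kappa'<\kappa$, every collection $\{x_\alpha:\alpha<\kappa'\}\subseteq S_E$ and every $\varepsilon>0$ there exists $x\in S_E$ such that $\Vert x_\alpha+x\Vert\geq 2-\varepsilon$ for all $\alpha<\kappa'$. It is $\kappa$-rigid octahedral if this holds with $\varepsilon=0$, i.e. for every such collection there is $x\in S_E$ with $\Vert x_\alpha+x\Vert=2$ for all $\alpha<\kappa'$. A point $y\in S_Y$ is a strongly exposed point of $B_Y$ if there is $f\in S_{Y^*}$ with $f(y)=1$ such that every sequence $(y_n)$ in $B_Y$ with $f(y_n)\to 1$ converges to $y$ in norm. *)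

(* Defs.v *)
From HB Require Import structures.
From mathcomp Require Import all_boot all_order all_algebra.
From mathcomp Require Import all_classical all_reals all_analysis.

Set Implicit Arguments.
Unset Strict Implicit.
Unset Printing Implicit Defensive.

Import Order.TTheory GRing.Theory Num.Theory.
Import numFieldNormedType.Exports.

Local Open Scope classical_set_scope.
Local Open Scope card_scope.
Local Open Scope ring_scope.

Section BoundedOperators.
Context {R : realType} (Y X : normedModType R).

Definition bounded_op_pred : {pred Y -> X} := fun f =>
  `[< linear f /\ exists M : R, forall y, `|f y| <= M * `|y| >].

Lemma bounded_op_submod_closed : submod_closed bounded_op_pred.
Proof.
split.
  apply/asboolP; split; first by move=> a u v; rewrite [RHS](_ : _ = a *: 0 + 0)// scaler0 addr0.
  by exists 0 => y; rewrite [leLHS](_ : _ = `|0 : X|)// normr0 mul0r.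
move=> a f g /asboolP[lf [M fM]] /asboolP[lg [N gN]]; apply/asboolP; split.
  move=> b u v; rewrite !fctE lf lg !scalerDr !scalerA.
  by rewrite addrACA (mulrC a b).
exists (`|a| * M + N) => y; rewrite !fctE.
rewrite (le_trans (ler_normD _ _))// normrZ mulrDl lerD//.
by rewrite -mulrA ler_wpM2l.
Qed.

HB.instance Definition _ := GRing.isSubmodClosed.Build R (Y -> X)
  bounded_op_pred bounded_op_submod_closed.

Record boundedOp := BoundedOp {
  bounded_op_fun :> Y -> X ;
  bounded_op_subproof : bounded_op_fun \in bounded_op_pred }.

HB.instance Definition _ := [isSub for bounded_op_fun].
HB.instance Definition _ := [Choice of boundedOp by <:].
HB.instance Definition _ := [SubChoice_isSubLmodule of boundedOp by <:].

Lemma bounded_op_linear (f : boundedOp) : linear f.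
Proof. by case: f => f /= /asboolP[]. Qed.

HB.instance Definition _ (f : boundedOp) :=
  GRing.isLinear.Build R Y X *:%R f (bounded_op_linear f).

Lemma bounded_opP (f : boundedOp) : exists M : R, forall y, `|f y| <= M * `|y|.
Proof. by case: f => f /= /asboolP[]. Qed.

Definition op_norm (f : boundedOp) : R :=
  sup [set `|f y| | y in [set y : Y | `|y| <= 1]].

Lemma op_norm_has_sup (f : boundedOp) :
  has_sup [set `|f y| | y in [set y : Y | `|y| <= 1]].
Proof.
split; first by exists `|f 0|, 0 => //=; rewrite normr0.
have [M fM] := bounded_opP f; exists `|M| => _ [y /= y1 <-].
rewrite (le_trans (fM y))// (@le_trans _ _ (`|M| * `|y|)) ?ler_wpM2r ?ler_norm//.
by rewrite -[leRHS]mulr1 ler_wpM2l.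
Qed.

Lemma op_norm_ge0 (f : boundedOp) : 0 <= op_norm f.
Proof.
rewrite (@le_trans _ _ `|f 0|)//; apply: sup_upper_bound (op_norm_has_sup f) _ _.
by exists 0; rewrite /= ?normr0.
Qed.

Lemma le_op_norm (f : boundedOp) (y : Y) : `|f y| <= op_norm f * `|y|.
Proof.
have [->|y0] := eqVneq y 0; first by rewrite linear0 !normr0 mulr0.
have ny : 0 < `|y| by rewrite normr_gt0.
rewrite -ler_pdivrMr//; apply: sup_upper_bound (op_norm_has_sup f) _ _.
exists (`|y|^-1 *: y); rewrite /= ?linearZ/= normrZ gtr0_norm ?invr_gt0//.
  by rewrite mulVf ?gt_eqF.
by rewrite mulrC.
Qed.

Lemma op_norm_le (f : boundedOp) (M : R) :
  (forall y : Y, `|y| <= 1 -> `|f y| <= M) -> op_norm f <= M.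
Proof.
move=> fM; apply: ge_sup; first by case: (op_norm_has_sup f).
by move=> _ [y y1 <-]; exact: fM.
Qed.

Lemma op_normD (f g : boundedOp) : op_norm (f + g) <= op_norm f + op_norm g.
Proof.
apply: op_norm_le => y y1; rewrite (le_trans (ler_normD _ _))// lerD//.
  by rewrite (le_trans (le_op_norm f y))// ler_piMr// op_norm_ge0.
by rewrite (le_trans (le_op_norm g y))// ler_piMr// op_norm_ge0.
Qed.

Lemma op_normZ_le (a : R) (f : boundedOp) :
  op_norm (a *: f) <= `|a| * op_norm f.
Proof.
apply: op_norm_le => y y1; rewrite normrZ ler_wpM2l//.
by rewrite (le_trans (le_op_norm f y))// ler_piMr// op_norm_ge0.
Qed.

Lemma op_normZ (a : R) (f : boundedOp) : op_norm (a *: f) = `|a| * op_norm f.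
Proof.
apply/eqP; rewrite eq_le op_normZ_le/=.
have [->|a0] := eqVneq a 0; first by rewrite normr0 mul0r op_norm_ge0.
rewrite -ler_pdivlMl ?normr_gt0// -normfV.
by rewrite -[in leLHS](scale1r f) -(mulVf a0) -scalerA op_normZ_le.
Qed.

Lemma op_norm0_eq0 (f : boundedOp) : op_norm f = 0 -> f = 0.
Proof.
move=> f0; apply/val_inj/funext => y; apply/normr0_eq0/eqP.
by rewrite eq_le normr_ge0 (le_trans (le_op_norm f y))// f0 mul0r.
Qed.

HB.instance Definition _ :=
  Lmodule_isNormed.Build R boundedOp op_normD op_normZ op_norm0_eq0.

End BoundedOperators.

Definition card_lt (T U : Type) (A : set T) (B : set U) : Prop :=
  A #<= B /\ ~ (B #<= A).

Section LinearSpan.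
Context {R : realType} {V : normedModType R}.

Definition lin_subspace (E : set V) : Prop := submod_closed [in E].

Definition lin_span (A : set V) : set V :=
  [set x | exists (n : nat) (a : 'I_n -> R) (v : 'I_n -> V),
    (forall i, A (v i)) /\ x = \sum_(i < n) a i *: v i].

Definition spans_densely (E A : set V) : Prop :=
  A `<=` E /\ E `<=` closure (lin_span A).

(* [is_dens E D]: the cardinal of [D] is dens(E) *)
Definition is_dens (E D : set V) : Prop :=
  spans_densely E D /\ forall A, spans_densely E A -> D #<= A.

(* dens(E) < |K| *)
Definition dens_lt (E : set V) (K : Type) : Prop :=
  exists2 D, is_dens E D & card_lt D [set: K].

End LinearSpan.

Definition finite_rank {R : realType} {Y X : normedModType R} :
    set (boundedOp Y X) :=
  [set f | exists2 A : set X, finite_set A & range f `<=` lin_span A].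

(* The cardinal kappa is represented by a type [K] with |K| = kappa. Since any
   cardinal kappa' < kappa is the cardinal of some subset of [K], the
   collections of kappa' < kappa vectors are the families indexed by subsets
   [I] of [K] with |I| < |K|. The normed space is a linear subspace [E] of [V]
   with the induced norm. *)
Section Octahedrality.
Context {R : realType} {V : normedModType R}.

Definition octahedral (K : Type) (E : set V) : Prop :=
  forall (I : set K) (x : K -> V), card_lt I [set: K] ->
    (forall i, I i -> E (x i) /\ `|x i| = 1) ->
  forall eps : R, 0 < eps ->
  exists u, [/\ E u, `|u| = 1 & forall i, I i -> 2 - eps <= `|x i + u|].

Definition rigid_octahedral (K : Type) (E : set V) : Prop :=
  forall (I : set K) (x : K -> V), card_lt I [set: K] ->
    (forall i, I i -> E (x i) /\ `|x i| = 1) ->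
  exists u, [/\ E u, `|u| = 1 & forall i, I i -> `|x i + u| = 2].

End Octahedrality.

Section Convexity.
Context {R : realType} (Y : normedModType R).

Definition uniformly_convex : Prop :=
  forall eps : R, 0 < eps -> exists2 delta : R, 0 < delta &
  forall x y : Y, `|x| = 1 -> `|y| = 1 -> eps <= `|x - y| ->
    `|2^-1 *: (x + y)| <= 1 - delta.

Definition locally_uniformly_rotund : Prop :=
  forall (y : Y) (y_ : nat -> Y), `|y| = 1 -> (forall n, `|y_ n| = 1) ->
    `|y_ n + y| @[n --> \oo] --> (2 : R) -> y_ @ \oo --> y.

Definition strongly_exposed_point (y : Y) : Prop :=
  `|y| = 1 /\ exists f : boundedOp Y R^o, [/\ `|f| = 1, f y = 1 &
    forall y_ : nat -> Y, (forall n, `|y_ n| <= 1) ->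
      (f (y_ n) : R) @[n --> \oo] --> (1 : R) -> y_ @ \oo --> y].

End Convexity.

(* Main.v *)
(* Let T be a unit vector of H with |f_w (.) z + T| close (resp. equal) to 2 for
   all z and w in dense subsets of the unit spheres of Z and W, where f_w is a
   norm-one functional exposing w and f_w (.) z is the rank-one operator
   y |-> f_w(y) z. A point v of the unit ball where f_w (.) z + T almost attains
   its norm satisfies f_w(v) ~ 1 up to a sign, so v is close to w and |z + T w|
   is close to 2; density and convexity of the norm then give the inequality on
   all of Z and W. There are fewer than kappa pairs (z, w) because an infinite
   cardinal equals its square. Existence of f_w is the Hahn-Banach theorem. *)

Require Import Defs.
From HB Require Import structures.
From mathcomp Require Import all_boot all_order all_algebra.
From mathcomp Require Import all_classical all_reals all_analysis.
From mathcomp Require Import lra.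

Set Implicit Arguments.
Unset Strict Implicit.
Unset Printing Implicit Defensive.

Import Order.TTheory GRing.Theory Num.Theory.
Import numFieldNormedType.Exports.

Local Open Scope classical_set_scope.
Local Open Scope ring_scope.

(** * Comparability of cardinals, and an infinite cardinal equals its square *)

Lemma card_le_fun (T U : Type) (u0 : U) (A : set T) (B : set U) :
  (A #<= B)%card ->
  exists2 f : T -> U, (forall x, A x -> B (f x)) &
    (forall x y, A x -> A y -> f x = f y -> x = y).
Proof.
move=> /card_leP[f].
(* Extending by the default [u0] off [A] gives a total function, so that later constructions avoid
   subtypes. *)
pose g x := if pselect (A x) is left Ax
  then set_val (f (exist _ x (mem_set Ax))) else u0.
exists g => [x Ax|x y Ax Ay]; rewrite /g.
  by case: pselect => // ?; exact: set_valP.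
case: pselect => // {}Ax; case: pselect => // {}Ay /val_inj fxy.
suff [] : exist (fun x => x \in A) x (mem_set Ax) =
          exist (fun x => x \in A) y (mem_set Ay) by [].
by apply: (inj (f := f)) fxy; rewrite in_setT.
Qed.

Lemma fun_card_le (T U : Type) (A : set T) (B : set U) (f : T -> U) :
  (forall x, A x -> B (f x)) ->
  (forall x y, A x -> A y -> f x = f y -> x = y) -> (A #<= B)%card.
Proof.
move=> fAB finj.
have [g] : $|{injfun A >-> B}|.
  apply/injfunPex; exists f => // x y; rewrite !inE => Ax Ay; exact: finj.
exact: (inj_card_le g).
Qed.

Lemma card_leTP (T U : Type) :
  ([set: T] #<= [set: U])%card <-> exists f : T -> U, injective f.
Proof.
split=> [|[f finj]]; last by apply: (fun_card_le (f := f)) => // x y _ _ /finj.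
have [[t _]|/forallNP T0] := pselect (exists t : T, True); last first.
  by exists (fun t => False_rect _ (T0 t I)) => t; case: (T0 t I).
move=> /card_leP[f].
exists (fun x => set_val (f (exist _ x (mem_set I)))) => x y /val_inj fxy.
suff [] : exist (fun x => x \in [set: T]) x (mem_set I) =
          exist (fun x => x \in [set: T]) y (mem_set I) by [].
by apply: (inj (f := f)) fxy; rewrite in_setT.
Qed.

(* Zorn's lemma on the graphs of partial injections from [T] to [U]. *)
Lemma card_leT_total (T U : Type) :
  ([set: T] #<= [set: U])%card \/ ([set: U] #<= [set: T])%card.
Proof.
pose P (G : set (T * U)) :=
  forall p q, G p -> G q -> (p.1 = q.1 <-> p.2 = q.2).
have [F FP Ftot|G [PG Gmax]] := @Zorn_bigcup _ P.
  move=> p q [A FA Ap] [B FB Bq].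
  have [AB|BA] := Ftot _ _ FA FB; first by apply: (FP _ FB) => //; exact: AB.
  by apply: (FP _ FA) => //; exact: BA.
have [/choice[f Gf]|/existsNP[t tG]] := pselect (forall t, exists u, G (t, u)).
  left; apply/card_leTP; exists f => t t' ff'.
  exact: (PG _ _ (Gf t) (Gf t')).2.
have [/choice[g Gg]|/existsNP[u uG]] := pselect (forall u, exists t, G (t, u)).
  right; apply/card_leTP; exists g => u u' gg'.
  exact: (PG _ _ (Gg u) (Gg u')).1.
(* Here [t] is outside the domain of [G] and [u] outside its range, so adjoining [(t, u)] keeps [P]
   and contradicts maximality. *)
exfalso; apply: (Gmax (G `|` [set (t, u)])).
  split; first by move=> ?; left.
  by move=> /(_ (t, u) (or_intror erefl)) Gtu; apply: tG; exists u.
move=> [x1 x2] [y1 y2] /= [Gx|[-> ->]] [Gy|[-> ->]] //=.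
- exact: (PG (x1, x2) (y1, y2)).
- by split=> xE; exfalso; rewrite xE in Gx; 
     [apply: tG; exists x2|apply: uG; exists x1].
- by split=> xE; exfalso; rewrite -xE in Gy; 
     [apply: tG; exists y2|apply: uG; exists y1].
Qed.

Lemma card_le_total (T U : Type) (A : set T) (B : set U) :
  (A #<= B)%card \/ (B #<= A)%card.
Proof.
have [AB|BA] := card_leT_total A B; [left|right].
  by rewrite -(card_le_eql (card_setT A)) -(card_le_eqr (card_setT B)).
by rewrite -(card_le_eql (card_setT B)) -(card_le_eqr (card_setT A)).
Qed.

(* Zorn's lemma on the graphs [G] of injections [D * D -> D], where [D] is
   recovered from [G] as its diagonal domain; starting from a countable [D]
   keeps [D] infinite. At a maximal [G] the complement of [D] embeds into [D],
   for otherwise a copy [E] of [D] outside [D] absorbs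
   [(D + E) * (D + E) - D * D]. *)
Lemma card_le_square (T : Type) :
  ([set: nat] #<= [set: T])%card -> ([set: T * T] #<= [set: T])%card.
Proof.
move=> /card_leTP[i iinj].
pose D (G : set (T * T * T)) x := exists z, G (x, x, z).
pose G0 : set (T * T * T) :=
  [set p | exists m n, p = (i m, i n, i (pickle (m, n)))].
(* In order: [G] is the graph of an injection, all entries lie in [D G], and every pair from [D G]
   is an argument. The last clause is restricted to nonempty [G] because Zorn's lemma also asks for
   the union of the empty chain. *)
pose P (G : set (T * T * T)) := [/\
  forall p q, G p -> G q -> (p.1 = q.1 <-> p.2 = q.2),
  forall x y z, G (x, y, z) -> [/\ D G x, D G y & D G z],
  forall x y, D G x -> D G y -> exists z, G (x, y, z) &
  G !=set0 -> G0 `<=` G].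
have [F FP Ftot|G [[Ginj Gdom Gtot G0G] Gmax]] := @Zorn_bigcup _ P.
  have Fub A B : F A -> F B -> exists2 C, F C & A `<=` C /\ B `<=` C.
    move=> FA FB; have [AB|BA] := Ftot _ _ FA FB; first by exists B => //; split.
    by exists A => //; split.
  have DF A x : F A -> D A x -> D (\bigcup_(X in F) X) x.
    by move=> FA [z Az]; exists z, A.
  split.
  - move=> p q [A FA Ap] [B FB Bq].
    have [C FC [AC BC]] := Fub _ _ FA FB; have [Cinj _ _ _] := FP _ FC.
    by apply: Cinj; [exact: AC|exact: BC].
  - move=> x y z [A FA Ap]; have [_ Adom _ _] := FP _ FA.
    by have [? ? ?] := Adom _ _ _ Ap; split; exact: (DF A).
  - move=> x y [z [A FA Az]] [w [B FB Bw]].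
    have [C FC [AC BC]] := Fub _ _ FA FB; have [_ _ Ctot _] := FP _ FC.
    have [||t Ct] := Ctot x y; [by exists z; apply: AC|by exists w; apply: BC|].
    by exists t, C.
  - move=> [p [A FA Ap]]; have [_ _ _ AG0] := FP _ FA.
    by move=> q qG0; exists A => //; apply: AG0 => //; exists p.
have PG0 : P G0.
  have DG0 m : D G0 (i m) by exists (i (pickle (m, m))), m, m.
  split=> //.
  - move=> _ _ [m [n ->]] [m' [n' ->]] /=; split=> [[/iinj -> /iinj ->]//|].
    by move=> /iinj/(pcan_inj pickleK)[-> ->].
  - by move=> _ _ _ [m [n [-> -> ->]]].
  - move=> _ _ [z [m [_ [-> _ _]]]] [w [n [_ [-> _ _]]]].
    by exists (i (pickle (m, n))), m, n.
  - by move=> _ q.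
(* The empty graph is not maximal, since [G0] properly extends it. *)
have {}G0G : G0 `<=` G.
  have [|GE] := pselect (G !=set0); first exact: G0G.
  have G00 : G0 (i 0, i 0, i (pickle (0, 0)))%N by exists 0%N, 0%N.
  case: (Gmax G0) => //; split; first by move=> q Gq; case: GE; exists q.
  by move=> /(_ _ G00) Gq; apply: GE; eexists; exact: Gq.
have Di n : D G (i n) by exists (i (pickle (n, n))); apply: G0G; exists n, n.
have [c Gc] : exists c : T * T -> T,
    forall x y, D G x -> D G y -> G (x, y, c (x, y)).
  suff /choice[c Gc] : forall p, exists z, D G p.1 -> D G p.2 -> G (p, z).
    by exists c => x y ? ?; apply: Gc.
  move=> [x y] /=; have [[/Gtot + /[dup] Dy]|Dxy] := pselect (D G x /\ D G y).
    by move=> /[apply] -[z Gz]; exists z.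
  by exists (i 0%N) => ? ?; case: Dxy.
have Dc x y : D G x -> D G y -> D G (c (x, y)).
  by move=> Dx Dy; have [] := Gdom _ _ _ (Gc _ _ Dx Dy).
have cinj x y x' y' : D G x -> D G y -> D G x' -> D G y' ->
    c (x, y) = c (x', y') -> x = x' /\ y = y'.
  move=> Dx Dy Dx' Dy' /(Ginj _ _ (Gc _ _ Dx Dy) (Gc _ _ Dx' Dy')).2.
  by case.
(* The distinct tags [i 0] and [i 1] embed the union of [D G] and [E] into pairs from [D G], which
   [c] sends back into [D G]. *)
have absorb (E : set T) (j : T -> T) : (forall x, E x -> D G (j x)) ->
    (forall x y, E x -> E y -> j x = j y -> x = y) ->
    exists2 k : T -> T, (forall x, D G x \/ E x -> D G (k x)) &
      forall x y, D G x \/ E x -> D G y \/ E y -> k x = k y -> x = y.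
  move=> jD jinj.
  pose k x := if pselect (D G x) then c (i 0%N, x) else c (i 1%N, j x).
  have i01 : i 0%N <> i 1%N by move=> /iinj.
  exists k => [x|x y]; rewrite /k.
    by case: pselect => [Dx _|nDx [//|/jD Ex]]; exact: Dc.
  case: pselect => [Dx _|nDx [//|Ex]]; case: pselect => [Dy _|nDy [//|Ey]].
  - by move=> /cinj[].
  - by move=> /cinj[] //; exact: jD.
  - by move=> /cinj[] //; [exact: jD|move=> /esym].
  - by move=> /cinj[] //; [exact: jD|exact: jD|move=> _; exact: jinj].
have [CD|DC] := card_le_total (~` D G) (D G).
  have [j jD jinj] := card_le_fun (i 0%N) CD.
  have [k kD kinj] := absorb _ _ jD jinj.
  have DC x : D G x \/ (~` D G) x by exact: lem.
  apply/card_leTP; exists (fun p => c (k p.1, k p.2)) => -[x y] [x' y'] /=.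
  by move=> /cinj[]; [exact: kD..|move=> /kinj -> // /kinj -> //].
have [g gD ginj] := card_le_fun (i 0%N) DC; exfalso.
pose E := g @` D G.
have [j jK] : exists j, forall x, E x -> D G (j x) /\ g (j x) = x.
  suff /choice[j] : forall x, exists y, E x -> D G y /\ g y = x by exists j.
  move=> x; have [[y Dy <-]|nEx] := pselect (E x); first by exists y.
  by exists x.
have [||k kD kinj] := absorb E j.
- by move=> x /jK[].
- by move=> x y Ex Ey jxy; rewrite -(jK x Ex).2 jxy (jK y Ey).2.
pose D' x := D G x \/ E x.
pose h p := g (c (k p.1, k p.2)).
have hE x y : D' x -> D' y -> E (h (x, y)).
  by move=> ? ?; exists (c (k x, k y)) => //; apply: Dc; exact: kD.
have hinj x y x' y' : D' x -> D' y -> D' x' -> D' y' ->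
    h (x, y) = h (x', y') -> (x, y) = (x', y').
  move=> Dx Dy Dx' Dy' /ginj /= cc.
  have /cinj[] : c (k x, k y) = c (k x', k y').
    by apply: cc; apply: Dc; exact: kD.
  - exact: kD.
  - exact: kD.
  - exact: kD.
  - exact: kD.
  - by move=> /kinj -> // /kinj -> //.
(* Pairs with a coordinate outside [D G] receive values in [E], hence outside [D G]: they cannot
   collide with the values of [G]. *)
pose N : set (T * T * T) := [set p | [/\ D' p.1.1, D' p.1.2,
  ~ (D G p.1.1 /\ D G p.1.2) & p.2 = h p.1]].
have ED x : E x -> ~ D G x by move=> [y Dy <-]; exact: gD.
have D'N x : D (G `|` N) x <-> D' x.
  split=> [[z [Gz|[]//]]|].
    by left; exists z.
  move=> D'x; have [[z Gz]|nDx] := pselect (D G x); first by exists z; left.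
  by exists (h (x, x)); right; split => //= -[].
apply: (Gmax (G `|` N)).
  split; first by move=> ?; left.
  have [z Gz] := Di 0%N; have gE : E (g (i 0%N)) by exists (i 0%N).
  move=> /(_ (g (i 0%N), g (i 0%N), h (g (i 0%N), g (i 0%N)))) GN.
  have /GN : (G `|` N) (g (i 0%N), g (i 0%N), h (g (i 0%N), g (i 0%N))).
    by right; split; [right|right|case=> /(ED _ gE)|].
  by move=> /Gdom[/(ED _ gE)].
split.
- move=> [[x y] z] [[x' y'] z'] /=.
  move=> [Gz|[/= Dx Dy nDxy ->]] [Gz'|[/= Dx' Dy' nDxy' ->]].
  + exact: (Ginj _ _ Gz Gz').
  + split.
      move=> [xx yy]; rewrite -xx -yy in nDxy'.
      by have [? ? _] := Gdom _ _ _ Gz; case: nDxy'.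
    move=> zh; have [_ _ Dz] := Gdom _ _ _ Gz.
    by exfalso; apply: ED Dz; rewrite zh; exact: hE.
  + split.
      move=> [xx yy]; rewrite xx yy in nDxy.
      by have [? ? _] := Gdom _ _ _ Gz'; case: nDxy.
    move=> zh; have [_ _ Dz] := Gdom _ _ _ Gz'.
    by exfalso; apply: ED Dz; rewrite -zh; exact: hE.
  + by split=> [-> //|]; exact: hinj.
- move=> x y z [/Gdom[? ? ?]|[/= Dx Dy _ ->]].
    by split; apply/D'N; left.
  by split; apply/D'N => //; right; exact: hE.
- move=> x y /D'N Dx /D'N Dy.
  have [[Dx' Dy']|nDxy] := pselect (D G x /\ D G y).
    by exists (c (x, y)); left; exact: Gc.
  by exists (h (x, y)); right.
- by move=> _ q /G0G; left.
Qed.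

Lemma card_le_seq (T U : Type) :
  ([set: T] #<= [set: U])%card -> ([set: seq T] #<= [set: seq U])%card.
Proof.
move=> /card_leTP[f finj]; apply/card_leTP; exists (map f).
exact: inj_map.
Qed.

Lemma card_le_pair (T U T' U' : Type) :
  ([set: T] #<= [set: T'])%card -> ([set: U] #<= [set: U'])%card ->
  ([set: T * U] #<= [set: T' * U'])%card.
Proof.
move=> /card_leTP[f finj] /card_leTP[g ginj]; apply/card_leTP.
by exists (fun p => (f p.1, g p.2)) => -[x y] [x' y'] /= [/finj -> /ginj ->].
Qed.

Lemma card_seq_le (T : Type) :
  ([set: nat] #<= [set: T])%card -> ([set: seq T] #<= [set: T])%card.
Proof.
move=> natT; have /card_leTP[c cinj] := card_le_square natT.
have /card_leTP[i iinj] := natT; apply/card_leTP.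
(* The tags [i 0] and [i 1] in first position tell the code of the empty list from that of a
   nonempty one. *)
exists (foldr (fun x t => c (i 1%N, c (x, t))) (c (i 0%N, i 0%N))).
elim=> [|x s IHs] [|y t] //= /cinj[].
- by move=> /iinj.
- by move=> /iinj.
- by move=> /cinj[-> /IHs ->].
Qed.

(** * Bounds for the operator norm *)

Lemma bounded_op_of_linear (R : realType) (Y X : normedModType R) (g : Y -> X)
  (glin : linear g) (M : R) (gM : forall y, `|g y| <= M * `|y|) :
  exists f : boundedOp Y X, forall y, f y = g y.
Proof.
have gb : g \in bounded_op_pred (Y := Y) (X := X).
  by apply/asboolP; split=> //; exists M.
by exists (BoundedOp gb).
Qed.

Lemma ler_bounded_op (R : realType) (Y X : normedModType R)
  (f : boundedOp Y X) (y : Y) : `|f y| <= `|f| * `|y|.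
Proof. exact: le_op_norm. Qed.

Lemma ler_norm_bounded_op (R : realType) (Y X : normedModType R)
  (f : boundedOp Y X) (M : R) :
  (forall y : Y, `|y| <= 1 -> `|f y| <= M) -> `|f| <= M.
Proof. exact: op_norm_le. Qed.

Lemma gt_norm_bounded_op (R : realType) (Y X : normedModType R)
  (f : boundedOp Y X) (M : R) :
  M < `|f| -> exists2 y : Y, `|y| <= 1 & M < `|f y|.
Proof.
move=> Mf; apply: contrapT => nMf; move: Mf; apply/negP; rewrite -leNgt.
apply: ler_norm_bounded_op => y y1; rewrite leNgt; apply/negP => My.
by apply: nMf; exists y.
Qed.

(** * The Hahn-Banach theorem for a norming functional *)

Section hahn_banach.
Context {R : realType} {Y : normedModType R}.
Implicit Types G : set (Y * R).

Let closed_comb G := forall (a : R) v r w s,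
  G (v, r) -> G (w, s) -> G (a *: v + w, a * r + s).
Let dominated G := forall v r, G (v, r) -> r <= `|v|.

(** The one-dimensional extension step. The triangle inequality puts every [r - |v - v0|] below
    every [|v' + v0| - r'], so the supremum [c] of the former separates the two families. This
    settles [t = -1] and [t = 1], and scaling [G] gives every nonzero [t]. *)
Lemma dominated_extension G (v0 : Y) : G (0, 0) ->
  closed_comb G -> dominated G ->
  exists c : R, forall v r t, G (v, r) -> r + t * c <= `|v + t *: v0|.
Proof.
move=> G00 Gcl Gdom.
pose A : set R := [set x | exists v r, G (v, r) /\ x = r - `|v - v0|].
have A0 : A !=set0 by exists (0 - `|0 - v0|), 0, 0.
have Aub v' r' : G (v', r') -> ubound A (`|v' + v0| - r').
  move=> Gv' _ [v [r [Gv ->]]]; rewrite lerBrDr addrAC lerBlDr.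
  have := Gdom _ _ (Gcl 1 _ _ _ _ Gv Gv'); rewrite scale1r mul1r => /le_trans.
  apply; rewrite (_ : v + v' = (v' + v0) + (v - v0)) ?ler_normD//.
  by rewrite addrACA subrr addr0 addrC.
have Asup : has_sup A by split => //; eexists; exact: Aub G00.
have cge v r : G (v, r) -> r - `|v - v0| <= sup A.
  by move=> Gv; apply: sup_upper_bound => //; exists v, r.
have cle v r : G (v, r) -> sup A <= `|v + v0| - r.
  by move=> Gv; apply: ge_sup => //; exact: Aub.
have Gscale a v r : G (v, r) -> G (a *: v, a * r).
  by move=> Gv; have := Gcl a _ _ _ _ Gv G00; rewrite !addr0.
exists (sup A) => v r t Gv; have [t0|t0|->] := ltgtP t 0; last first.
- by rewrite mul0r scale0r !addr0; exact: Gdom.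
- have := cle _ _ (Gscale t^-1 _ _ Gv).
  rewrite -(ler_pM2l t0) mulrBr mulVKf ?gt_eqF// lerBrDl => /le_trans; apply.
  rewrite -[X in X * _](gtr0_norm t0) -normrZ scalerDr.
  by rewrite scalerA mulfV ?gt_eqF// scale1r.
- have s0 : 0 < - t by rewrite oppr_gt0.
  have := cge _ _ (Gscale (- t)^-1 _ _ Gv).
  rewrite -(ler_pM2l s0) mulrBr mulVKf ?gt_eqF// lerBlDr mulNr.
  rewrite -lerBlDl opprK => /le_trans; apply.
  rewrite -[X in X * _](gtr0_norm s0) -normrZ scalerBr.
  by rewrite scalerA mulfV ?gt_eqF// scale1r scaleNr opprK.
Qed.

(* Zorn's lemma on the graphs of partial linear functionals dominated by the
   norm; domination alone forces such a graph to be single-valued. *)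
Lemma norming_functional (y : Y) : `|y| = 1 ->
  exists f : boundedOp Y R^o, `|f| = 1 /\ f y = 1.
Proof.
move=> y1.
(* The last clause says that a nonempty [G] contains [(y, 1)]; stated this way it also holds for the
   union of the empty chain. *)
pose P G := [/\ closed_comb G, dominated G &
  forall v r, G (v, r) -> G (y, 1)].
have [F FP Ftot|G [[Gcl Gdom Gy] Gmax]] := @Zorn_bigcup _ P.
  split.
  - move=> a v r w s [A FA Av] [B FB Bw]; have [AB|BA] := Ftot _ _ FA FB.
      by exists B => //; have [Bcl _ _] := FP _ FB; apply: Bcl => //; exact: AB.
    by exists A => //; have [Acl _ _] := FP _ FA; apply: Acl => //; exact: BA.
  - by move=> v r [A FA Av]; have [_ Adom _] := FP _ FA; exact: Adom.
  - move=> v r [A FA Av]; have [_ _ Ay] := FP _ FA; exists A => //.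
    exact: Ay Av.
have {}Gy : G (y, 1).
  (* Without [(y, 1)] the graph [G] would be empty, and the functional on the line through [y] would
     properly extend it. *)
  apply: contrapT => nGy; apply: (Gmax [set p | exists a : R, p = (a *: y, a)]).
    split; first by move=> [v r] /Gy.
    move=> /(_ (y, 1)) Gy1; apply: nGy; apply: Gy1.
    by exists 1; rewrite scale1r.
  split.
  - move=> a _ _ _ _ [r [-> ->]] [s [-> ->]]; exists (a * r + s).
    by rewrite scalerDl scalerA.
  - by move=> _ _ [a [-> ->]]; rewrite normrZ y1 mulr1 ler_norm.
  - by move=> *; exists 1; rewrite scale1r.
have G00 : G (0, 0).
  by have := Gcl (-1) _ _ _ _ Gy Gy; rewrite scaleN1r mulN1r !addNr.
have Guniq v r s : G (v, r) -> G (v, s) -> r = s.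
  have H r' s' : G (v, r') -> G (v, s') -> r' <= s'.
    move=> Gr Gs; have := Gdom _ _ (Gcl (-1) _ _ _ _ Gs Gr).
    by rewrite scaleN1r mulN1r addNr normr0 addrC subr_le0.
  by move=> Gr Gs; apply/eqP; rewrite eq_le !H.
have /choice[f Gf] : forall v, exists r, G (v, r).
  move=> v0; apply: contrapT => nG.
  have [c Gc] := dominated_extension v0 G00 Gcl Gdom.
  pose G' : set (Y * R) := [set p | exists v r t,
    G (v, r) /\ p = (v + t *: v0, r + t * c)].
  have GG' : G `<=` G'.
    by move=> [v r] Gv; exists v, r, 0; rewrite scale0r mul0r !addr0.
  apply: (Gmax G').
    split=> // G'G; apply: nG; exists c; apply: G'G; exists 0, 0, 1.
    by rewrite scale1r mul1r !add0r.
  split.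
  - move=> a _ _ _ _ [v [r [t [Gv [-> ->]]]]] [w [s [u [Gw [-> ->]]]]].
    exists (a *: v + w), (a * r + s), (a * t + u); split; first exact: Gcl.
    rewrite scalerDr scalerDl scalerA mulrDr mulrDl mulrA.
    by rewrite addrACA (addrACA (a * r)).
  - by move=> _ _ [v [r [t [Gv [-> ->]]]]]; exact: Gc.
  - by move=> *; exact: GG'.
have flin : linear (f : Y -> R^o).
  by move=> a u v; apply: Guniq (Gf _) _; exact: Gcl.
have fle v : `|f v| <= 1 * `|v|.
  rewrite mul1r ler_norml; apply/andP; split; last exact: Gdom.
  rewrite lerNl -normrN; apply: Gdom.
  by have := Gcl (-1) _ _ _ _ (Gf v) G00; rewrite !addr0 scaleN1r mulN1r.
have [g gf] := bounded_op_of_linear flin fle.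
have gy : g y = 1 by rewrite gf; exact: Guniq (Gf y) Gy.
exists g; split=> //; apply/eqP; rewrite eq_le; apply/andP; split.
  apply: ler_norm_bounded_op => v v1; rewrite gf (le_trans (fle v))//.
  by rewrite mul1r.
by have := ler_bounded_op g y; rewrite gy y1 mulr1 normr1.
Qed.

End hahn_banach.

(** * Dense families of unit vectors, and norm estimates extended from them *)

Lemma rat_span_approx (R : realType) (V : normedModType R) (D : set V) (z : V)
  (eta : R) : 0 < eta -> closure (lin_span D) z ->
  exists s : seq (rat * D),
    `|z - \sum_(p <- s) (ratr p.1 : R) *: set_val p.2| < eta.
Proof.
move=> eta0 Dz; have eta2 : 0 < eta / 2 by rewrite divr_gt0.
have [_ [[n [a [v [Dv ->]]]] zv]] := Dz _ (nbhsx_ballx z _ eta2).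
have n0 : 0 < n.+1%:R :> R by rewrite ltr0n.
(* Using [n.+1] and, below, [1 + |v i|] keeps the denominators positive when [n = 0] or
   [v i = 0]. *)
have /choice[q aq] : forall i, exists q : rat,
    `|a i - ratr q| * `|v i| <= eta / 2 / n.+1%:R.
  move=> i; have v0 : 0 < 1 + `|v i| by rewrite ltr_wpDr.
  have e0 : 0 < eta / 2 / n.+1%:R / (1 + `|v i|) by rewrite !divr_gt0.
  have [|q] := @rat_in_itvoo R (a i - eta / 2 / n.+1%:R / (1 + `|v i|))
    (a i + eta / 2 / n.+1%:R / (1 + `|v i|)).
    by rewrite ltrD2l gtrN.
  rewrite in_itv/= => /andP[q1 q2]; exists q.
  rewrite (@le_trans _ _ (`|a i - ratr q| * (1 + `|v i|)))//.
    by rewrite ler_wpM2l// lerDr.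
  rewrite -ler_pdivlMr// ltW// ltr_norml.
  by rewrite ltrNl opprB ltrBlDl q2 ltrBlDl -ltrBlDr.
exists [seq (q i, exist _ (v i) (mem_set (Dv i))) | i <- index_enum 'I_n].
rewrite big_map/=; set y := \sum_i a i *: v i in zv; rewrite -ball_normE in zv.
rewrite -(subrKA y) (le_lt_trans (ler_normD _ _))// [ltRHS]splitr ltr_leD//.
rewrite /y -sumrB (le_trans (ler_norm_sum _ _ _))//.
rewrite (@le_trans _ _ (\sum_(i < n) eta / 2 / n.+1%:R))//.
  by apply: ler_sum => i _; rewrite -scalerBl normrZ.
rewrite sumr_const card_ord -[leLHS]mulr_natr -mulrA ler_piMr ?(ltW eta2)//.
by rewrite mulrC ler_pdivrMr// mul1r ler_nat.
Qed.

(** The vectors are normalized rational combinations of [D]: rational coefficients keep the index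
    type [seq (rat * D)] small enough to be counted. Combinations equal to 0 are replaced by
    [v0]. *)
Lemma dense_unit_family (R : realType) (V : normedModType R) (E D : set V)
  (v0 : V) : `|v0| = 1 -> spans_densely E D ->
  exists2 a : seq (rat * D) -> V, forall s, `|a s| = 1 &
    forall z (eta : R), E z -> 0 < eta -> exists s, `|z - `|z| *: a s| < eta.
Proof.
move=> v01 [_ EclD].
pose y (s : seq (rat * D)) := \sum_(p <- s) (ratr p.1 : R) *: set_val p.2.
exists (fun s => if y s == 0 then v0 else `|y s|^-1 *: y s) => [s|z eta Ez eta0].
  by case: eqP => // /eqP ys0; rewrite normrZ normfV normr_id mulVf ?normr_eq0.
have [->|z0] := eqVneq z 0.
  by exists [::]; rewrite normr0 scale0r subr0 normr0.
(* A distance below [|z|] forces the approximant to be nonzero. By the reverse triangle inequality,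
   normalizing it and rescaling to length [|z|] costs at most another [eta / 2]. *)
have m0 : 0 < Num.min (eta / 2) `|z| by rewrite lt_min divr_gt0 //= normr_gt0.
have [s] := rat_span_approx m0 (EclD _ Ez); rewrite -/(y s) lt_min => /andP[zs1 zs2].
exists s; have ys0 : y s != 0.
  by apply: contraTneq zs2 => ->; rewrite subr0 ltxx.
rewrite (negbTE ys0) -(subrKA (y s)) (le_lt_trans (ler_normD _ _))//.
rewrite [ltRHS]splitr ltrD// (le_lt_trans _ zs1)//.
rewrite scalerA -[X in X - _]scale1r -scalerBl normrZ.
rewrite -[X in _ * X]normr_id -normrM mulrBl mul1r mulfVK ?normr_eq0//.
by rewrite distrC ler_dist_dist.
Qed.

(** For [b <= a], write [a u + b v = a (u + v) - (a - b) v]: its norm is at least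
    [a (2 - e) - (a - b) = a + b - e a], and [e b >= 0]. *)
Lemma scaled_norm_lower_bound (R : realType) (V : normedModType R) (u v : V)
  (e a b : R) : 0 <= e -> 0 <= a -> 0 <= b -> `|u| <= 1 -> `|v| <= 1 ->
  2 - e <= `|u + v| -> (1 - e) * (a + b) <= `|a *: u + b *: v|.
Proof.
wlog ab : u v a b / b <= a => [hw|] e0 a0 b0 u1 v1 uv.
  have [|/ltW] := leP b a; first by move=> ?; exact: hw.
  by move=> ?; rewrite (addrC a) (addrC (a *: u)); apply: hw => //; rewrite (addrC v).
have -> : a *: u + b *: v = a *: (u + v) - (a - b) *: v.
  by rewrite scalerDr scalerBl opprB (addrC (b *: v)) -addrA addNKr.
rewrite (le_trans _ (lerB_dist _ _))// !normrZ !ger0_norm ?subr_ge0//.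
have := ler_wpM2l a0 uv.
have := ler_wpM2l (_ : 0 <= a - b) v1; rewrite subr_ge0 => /(_ ab).
have := mulr_ge0 e0 b0.
nra.
Qed.

(** Replacing [z] and [w] by multiples of [a s] and [b t] costs [eta / 2] each, because [T] does not
    increase norms; [eta] is arbitrary. *)
Lemma span_norm_lower_bound (R : realType) (Y X : normedModType R)
  (T : boundedOp Y X) (Z : set X) (W : set Y) (S S' : Type)
  (a : S -> X) (b : S' -> Y) (e : R) : 0 <= e -> `|T| <= 1 ->
  (forall s, `|a s| = 1) -> (forall t, `|b t| = 1) ->
  (forall z (eta : R), Z z -> 0 < eta -> exists s, `|z - `|z| *: a s| < eta) ->
  (forall w (eta : R), W w -> 0 < eta -> exists t, `|w - `|w| *: b t| < eta) ->
  (forall s t, 2 - e <= `|a s + T (b t)|) ->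
  forall z w, Z z -> W w -> (1 - e) * (`|z| + `|w|) <= `|z + T w|.
Proof.
move=> e0 T1 a1 b1 aZ bW abT z w Zz Ww; apply/ler_addgt0Pr => eta eta0.
have eta2 : 0 < eta / 2 by rewrite divr_gt0.
have [s zs] := aZ _ _ Zz eta2; have [t wt] := bW _ _ Ww eta2.
have Tb : `|T (b t)| <= 1 by rewrite (le_trans (ler_bounded_op _ _))// b1 mulr1.
have as1 : `|a s| <= 1 by rewrite a1.
rewrite (le_trans (scaled_norm_lower_bound e0 _ _ as1 Tb (abT s t)))//.
rewrite -linearZ (_ : `|z| *: a s + _ =
  (z + T w) - ((z - `|z| *: a s) + T (w - `|w| *: b t))).
  rewrite (le_trans (ler_normB _ _))// lerD2l (le_trans (ler_normD _ _))//.
  rewrite [leRHS]splitr lerD// ?ltW// (le_lt_trans (ler_bounded_op _ _))//.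
  by rewrite (le_lt_trans _ wt)// ler_piMl.
by rewrite linearB/= opprD addrACA !subKr.
Qed.

(** * Rank-one operators and slices of the unit ball *)

Lemma rank_one_op (R : realType) (Y X : normedModType R)
  (f : boundedOp Y R^o) (x : X) :
  exists g : boundedOp Y X, [/\ forall y, g y = (f y : R) *: x,
    finite_rank g & `|g| = `|f| * `|x|].
Proof.
have glin : linear (fun y => (f y : R) *: x).
  by move=> a u v; rewrite linearP scalerDl scalerA.
have [|g gE] := bounded_op_of_linear (M := `|f| * `|x|) glin.
  by move=> y; rewrite normrZ mulrAC ler_wpM2r// ler_bounded_op.
exists g; split=> //.
  exists [set x] => // _ [y _ <-].
  exists 1, (fun=> f y), (fun=> x); split=> //.
  by rewrite big_ord1 gE.
apply/eqP; rewrite eq_le; apply/andP; split.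
  apply: ler_norm_bounded_op => y y1.
  rewrite gE normrZ ler_wpM2r// (le_trans (ler_bounded_op _ _))//.
  by rewrite ler_piMr.
have [->|x0] := eqVneq x 0; first by rewrite normr0 mulr0.
rewrite -ler_pdivlMr ?normr_gt0//; apply: ler_norm_bounded_op => y y1.
rewrite ler_pdivlMr ?normr_gt0// -normrZ -gE (le_trans (ler_bounded_op _ _))//.
by rewrite ler_piMr.
Qed.

(* [v] is chosen to almost attain the norm of [g + T]; since [T] has norm at
   most 1, this forces [f v] to be close to 1 up to a sign. *)
Lemma exposed_rank_one (R : realType) (Y X : normedModType R)
  (f : boundedOp Y R^o) (x : X) (g T : boundedOp Y X) (y : Y) (d e : R) :
  `|f| <= 1 -> `|x| = 1 -> `|T| <= 1 -> (forall v, g v = (f v : R) *: x) ->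
  (forall v, `|v| <= 1 -> 1 - d < f v -> `|v - y| <= e) ->
  2 - d < `|g + T| -> 2 - d *+ 2 - e <= `|x + T y|.
Proof.
move=> f1 x1 T1 gE exp gT.
(* Passing to [- v] if necessary makes [f v] nonnegative. *)
have [v v1 [fv gTv]] : exists2 v, `|v| <= 1 &
    0 <= (f v : R) /\ 2 - d < `|(f v : R) *: x + T v|.
  have [v v1] := gt_norm_bounded_op gT; rewrite -[(g + T) v]/(g v + T v) gE.
  move=> gTv.
  have [fv|fv] := leP 0 (f v : R); first by exists v.
  exists (- v); rewrite ?normrN// !linearN/= scaleNr -opprD normrN oppr_ge0.
  by split=> //; exact: ltW.
have fv1 : f v <= 1 :> R.
  rewrite (le_trans (ler_norm _))// (le_trans (ler_bounded_op _ _))//.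
  by rewrite mulr_ile1.
have Tv : `|T v| <= 1 by rewrite (le_trans (ler_bounded_op _ _))// mulr_ile1.
have dfv : 1 - d < f v.
  have := lt_le_trans gTv (ler_normD _ _).
  by rewrite normrZ x1 mulr1 (ger0_norm fv) => ?; lra.
have vy := exp _ v1 dfv.
have Tvy : `|T (v - y)| <= e.
  by rewrite (le_trans _ vy)// (le_trans (ler_bounded_op _ _))// ler_piMl.
(* Replacing [f v] by 1 costs [1 - f v < d] and replacing [v] by [y] costs [e]; with the [d] already
   lost in the hypothesis this gives [2 - 2 d - e]. *)
move: gTv; rewrite (_ : (f v : R) *: x + T v =
  (x + T y) - ((1 - f v : R) *: x - T (v - y))); last first.
  rewrite [T (v - y)]linearB scalerBl scale1r opprB.
  by rewrite [X in _ = _ + X]addrC addrACA subKr (addrC (T y)) subrK.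
move=> /lt_le_trans => /(_ _ (ler_normB _ _)) H1.
have := ler_normB ((1 - f v : R) *: x) (T (v - y)).
rewrite normrZ x1 mulr1 ger0_norm ?subr_ge0// => H2.
lra.
Qed.

(** Both rotundity conditions concern unit vectors, whereas slices consist of points of the ball;
    this moves [v] to the sphere without decreasing [f]. *)
Lemma normalize_toward (R : realType) (Y : normedModType R)
  (f : boundedOp Y R^o) (y v : Y) :
  `|f| <= 1 -> `|y| = 1 -> f y = 1 -> `|v| <= 1 ->
  exists u, [/\ `|u| = 1, f v <= f u :> R & `|v - u| <= 2 * (1 - f v)].
Proof.
move=> f1 y1 fy v1.
have fle w : f w <= `|w| :> R.
  rewrite (le_trans (ler_norm _))// (le_trans (ler_bounded_op _ _))//.
  by rewrite ler_piMl.
(* If [f v <= 0], then [y] itself works, as [|v - y| <= 2]. Otherwise [v / |v|] is at distance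
   [1 - |v| <= 1 - f v]. *)
have [fv|fv] := ltP 0 (f v : R); last first.
  exists y; rewrite fy (le_trans fv)//; split=> //.
  rewrite (le_trans (ler_normB _ _))// y1.
  by move: fv v1; set c := (f v : R) => ? ?; lra.
have v0 : 0 < `|v| by exact: lt_le_trans (fle v).
exists (`|v|^-1 *: v); split.
- by rewrite normrZ normfV normr_id mulVf ?gt_eqF.
- by rewrite linearZ/= -[leLHS]mul1r ler_wpM2r ?(ltW fv)// invf_ge1.
- rewrite -[X in `|X - _|]scale1r -scalerBl normrZ.
  rewrite -[X in _ * X]normr_id -normrM.
  rewrite mulrBl mul1r mulVf ?gt_eqF// distrC ger0_norm ?subr_ge0//.
  have := fle v; move: v1; set c := (f v : R) => ? ?; lra.
Qed.

(** The point is that [d] is the same for all [f] and [y]. If the normalized vector [u] were [e / 2]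
    away from [y], the midpoint would have norm at most [1 - d], while [f] exceeds [1 - d] there.
    The bound [e / 4] makes [|v - u| <= e / 2]. *)
Lemma uniformly_convex_exposed (R : realType) (Y : normedModType R) :
  uniformly_convex Y -> forall e : R, 0 < e -> exists2 d : R, 0 < d &
  forall (f : boundedOp Y R^o) (y : Y), `|f| <= 1 -> `|y| = 1 -> f y = 1 ->
  forall v, `|v| <= 1 -> 1 - d < f v -> `|v - y| <= e.
Proof.
move=> ucY e e0; have e2 : 0 < e / 2 by rewrite divr_gt0.
have [d d0 ucd] := ucY _ e2.
exists (Num.min d (e / 4)); first by rewrite lt_min d0 divr_gt0.
move=> f y f1 y1 fy v v1 fv.
have [u [u1 fvu vu]] := normalize_toward f1 y1 fy v1.
have [d1 d2] : Num.min d (e / 4) <= d /\ Num.min d (e / 4) <= e / 4.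
  by rewrite !ge_min !lexx orbT.
rewrite -(subrKA u) (le_trans (ler_normD _ _))//.
have [/(ucd _ _ u1 y1)|uy] := leP (e / 2) `|u - y|.
  have : f (2^-1 *: (u + y)) <= `|2^-1 *: (u + y)| :> R.
    rewrite (le_trans (ler_norm _))// (le_trans (ler_bounded_op _ _))//.
    by rewrite ler_piMl.
  rewrite linearZ linearD/= fy -[_ *: _]/(2^-1 * _ : R).
  move: fv fvu; set c := (f v : R); set c' := (f u : R) => ? ? ? ?; lra.
move: fv fvu vu; set c := (f v : R) => ? ? ?; lra.
Qed.

(** If no [d] works, the values [1 / (n + 1)] yield a sequence with [f (v n)] tending to 1 that
    stays [e] away from [y]. Here [d] may depend on [f] and [y]. *)
Lemma strongly_exposed_uniform (R : realType) (Y : normedModType R)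
  (f : boundedOp Y R^o) (y : Y) :
  (forall y_ : nat -> Y, (forall n, `|y_ n| <= 1) ->
      (f (y_ n) : R) @[n --> \oo] --> (1 : R) -> y_ @ \oo --> y) ->
  `|f| <= 1 ->
  forall e : R, 0 < e -> exists2 d : R, 0 < d &
  forall v, `|v| <= 1 -> 1 - d < f v -> `|v - y| <= e.
Proof.
move=> exp f1 e e0; apply: contrapT => nexp.
have /choice[v Hv] : forall n : nat, exists v : Y,
    [/\ `|v| <= 1, 1 - n.+1%:R^-1 < f v & e < `|v - y|].
  move=> n; apply: contrapT => nv; apply: nexp; exists n.+1%:R^-1 => // v v1 fv.
  by rewrite leNgt; apply/negP => ev; apply: nv; exists v.
have fv : (f (v n) : R) @[n --> \oo] --> (1 : R).
  apply: (@squeeze_cvgr _ _ _ _ (fun n => 1 - n.+1%:R^-1) (fun=> 1)).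
  - near=> n; have [v1 /ltW -> _] := Hv n.
    rewrite (le_trans (ler_norm _))// (le_trans (ler_bounded_op _ _))//.
    by rewrite mulr_ile1.
  - rewrite -[X in _ --> X]subr0; apply: cvgB; first exact: cvg_cst.
    exact: cvg_harmonic.
  - exact: cvg_cst.
have v1 n : `|v n| <= 1 by have [] := Hv n.
have /cvgrPdist_lt/(_ _ e0)[n _ /(_ n (leqnn n))] := exp v v1 fv.
by have [_ _ ev] := Hv n; rewrite /= distrC ltNge (ltW ev).
Unshelve. all: by end_near. Qed.

(** Any norming functional [f] of [y] exposes it: for the normalized [u n],
    [f (v n) + 1 <= |u n + y| <= 2], so [u n] tends to [y], and [v n - u n] tends to 0. *)
Lemma locally_uniformly_rotund_strongly_exposed (R : realType)
  (Y : normedModType R) : locally_uniformly_rotund Y ->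
  forall y : Y, `|y| = 1 -> strongly_exposed_point y.
Proof.
move=> lurY y y1; split=> //.
have [f [f1 fy]] := norming_functional y1; exists f; split=> // v v1 fv.
have fle1 : `|f| <= 1 by rewrite f1.
have /choice[u uv] : forall n, exists u,
    [/\ `|u| = 1, f (v n) <= f u :> R & `|v n - u| <= 2 * (1 - f (v n))].
  by move=> n; exact: (normalize_toward fle1 y1 fy (v1 n)).
have uy : u @ \oo --> y.
  apply: lurY => // [n|]; first by have [] := uv n.
  apply: (@squeeze_cvgr _ _ _ _ (fun n => (f (v n) : R) + 1) (fun=> 2)).
  - near=> n; have [u1 fvu _] := uv n; apply/andP; split.
      rewrite -[X in _ + X]fy (le_trans (lerD fvu (lexx _)))// -linearD.
      rewrite (le_trans (ler_norm _))// (le_trans (ler_bounded_op _ _))//.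
      by rewrite f1 mul1r.
    by rewrite (le_trans (ler_normD _ _))// u1 y1.
  - by apply: cvgD => //; exact: cvg_cst.
  - exact: cvg_cst.
have vu : v n - u n @[n --> \oo] --> (0 : Y).
  apply: norm_cvg0.
  apply: (@squeeze_cvgr _ _ _ _ (fun=> 0) (fun n => 2 * (1 - f (v n) : R))).
  - by near=> n; have [_ _ ->] := uv n; rewrite normr_ge0.
  - exact: cvg_cst.
  - rewrite -(mulr0 2) -(subrr 1); apply: cvgMr.
    by apply: cvgB => //; exact: cvg_cst.
rewrite -[y]add0r (_ : v = (fun n => (v n - u n) + u n)); first exact: cvgD.
by apply/funext => n; rewrite subrK.
Unshelve. all: by end_near. Qed.

(** * Counting the pairs and indexing them by a subset of [K] *)

Lemma card_lt_max (K T U : Type) (A : set T) (B : set U) :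
  card_lt A [set: K] -> card_lt B [set: K] ->
  exists C : set K, [/\ (A #<= C)%card, (B #<= C)%card & card_lt C [set: K]].
Proof.
wlog AB : T U A B / (A #<= B)%card => [hw AK BK|[AK KA] [BK KB]].
  have [AB|BA] := card_le_total A B; first exact: hw.
  by have [C [? ? ?]] := hw _ _ _ _ BA BK AK; exists C.
have [C /card_eqPle[CB BC] _] := card_subP _ _ BK.
exists C; split=> //; first exact: card_le_trans BC.
by split=> [|KC]; [exact: card_le_trans BK|apply: KB; exact: card_le_trans CB].
Qed.

(** As [K] is uncountable, some infinite [C] smaller than [K] dominates both [A] and [B]; forming
    lists and pairs does not lead beyond the cardinal of [C]. *)
Lemma card_lt_seq_rat_prod (K T U : Type) (A : set T) (B : set U) :
  ~ countable [set: K] ->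
  card_lt A [set: K] -> card_lt B [set: K] ->
  exists2 e : seq (rat * A) * seq (rat * B) -> K, injective e &
    card_lt (range e) [set: K].
Proof.
move=> Kunc AK BK.
have natK : card_lt [set: nat] [set: K].
  by split=> //; have [] := card_le_total [set: nat] [set: K].
have [C0 [AC0 BC0 C0K]] := card_lt_max AK BK.
have [C [C0C natC [CK KC]]] := card_lt_max C0K natK.
have natC' : ([set: nat] #<= [set: C])%card by rewrite (card_le_eqr (card_setT C)).
have seq_le T' (D : set T') : (D #<= C0)%card ->
    ([set: seq (rat * D)] #<= [set: C])%card.
  move=> DC0; apply: (card_le_trans _ (card_seq_le natC')).
  apply/card_le_seq/(card_le_trans _ (card_le_square natC'))/card_le_pair.
    by apply: card_le_trans natC'; have /card_eqPle[] := card_rat.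
  rewrite (card_le_eql (card_setT D)) (card_le_eqr (card_setT C)).
  exact: card_le_trans C0C.
have JC : ([set: seq (rat * A) * seq (rat * B)] #<= [set: C])%card.
  apply: (card_le_trans _ (card_le_square natC')).
  by apply: card_le_pair; exact: seq_le.
have CK' : ([set: C] #<= [set: K])%card by rewrite (card_le_eql (card_setT C)).
have /card_leTP[e einj] := card_le_trans JC CK'.
exists e => //; split; first exact: card_leT.
move=> Ke; apply: KC; rewrite -(card_le_eqr (card_setT C)).
exact: card_le_trans (card_le_trans Ke (card_image_le _ _)) JC.
Qed.

(** This reindexes a family over [J] as a function on all of [K], the form required by [octahedral];
    [j0] is the value off the range. *)
Lemma left_inverse_of_inj (J K : Type) (j0 : J) (e : J -> K) :
  injective e -> exists i : K -> J, cancel e i.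
Proof.
move=> einj; suff /choice[i iP] : forall k, exists j, range e k -> e j = k.
  by exists i => j; apply: einj; apply: iP; exists j.
move=> k; have [[j _ <-]|nk] := pselect (range e k); first by exists j.
by exists j0.
Qed.

Lemma lin_subspace0 (R : realType) (V : normedModType R) (E : set V) :
  lin_subspace E -> E 0.
Proof. by move=> [E0 _]; exact: set_mem E0. Qed.

Lemma lin_subspaceB (R : realType) (V : normedModType R) (E : set V) u v :
  lin_subspace E -> E u -> E v -> E (u - v).
Proof.
move=> [_ /(_ (-1) v u) Evu] Eu Ev; rewrite addrC -scaleN1r.
by apply/set_mem/Evu; apply: mem_set.
Qed.

(* Unit vectors, needed for the families [a] and [b] when [Z] or [W] is
   trivial, come from the operator of norm 1. *)
Lemma unit_rank_one_family (R : realType) (X Y : normedModType R) (K : Type)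
  (H : set (boundedOp Y X)) (Z : set X) (W : set Y) :
  ~ countable [set: K] -> finite_rank `<=` H ->
  (exists T : boundedOp Y X, `|T| = 1) -> dens_lt Z K -> dens_lt W K ->
  forall (f : Y -> boundedOp Y R^o),
    (forall y, `|y| = 1 -> `|f y| = 1) ->
  exists (S S' : Type) (a : S -> X) (b : S' -> Y) (I : set K)
    (x : K -> boundedOp Y X), [/\
    (forall s, `|a s| = 1) /\ (forall t, `|b t| = 1),
    forall z (eta : R), Z z -> 0 < eta -> exists s, `|z - `|z| *: a s| < eta,
    forall w (eta : R), W w -> 0 < eta -> exists t, `|w - `|w| *: b t| < eta,
    card_lt I [set: K] /\ (forall i, I i -> H (x i) /\ `|x i| = 1) &
    forall s t, exists2 i, I i & forall v, x i v = (f (b t) v : R) *: a s].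
Proof.
move=> Kunc FH [T T1] [A [ZA _] AK] [B [WB _] BK] f f1.
have [y Ty] : exists y, T y != 0.
  have [|y _] := @gt_norm_bounded_op _ _ _ T 0; first by rewrite T1.
  by rewrite normr_gt0; exists y.
have y0 : y != 0 by apply: contraNneq Ty => ->; rewrite linear0.
have unit (V : normedModType R) (v : V) : v != 0 -> `| `|v|^-1 *: v | = 1.
  by move=> v0; rewrite normrZ normfV normr_id mulVf ?normr_eq0.
have [a a1 aZ] := dense_unit_family (unit _ _ Ty) ZA.
have [b b1 bW] := dense_unit_family (unit _ _ y0) WB.
have [e einj eK] := card_lt_seq_rat_prod Kunc AK BK.
have [i eK'] := left_inverse_of_inj ([::], [::]) einj.
have /choice[g gP] : forall p, exists g : boundedOp Y X,
    [/\ forall v, g v = (f (b p.2) v : R) *: a p.1, finite_rank g & `|g| = 1].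
  move=> p; have [g [gE gF g1]] := rank_one_op (f (b p.2)) (a p.1).
  by exists g; split=> //; rewrite g1 f1// a1 mulr1.
exists _, _, a, b, (range e), (g \o i); split=> //.
  by split=> // _ [p _ <-] /=; rewrite eK'; have [_ /FH] := gP p.
move=> s t; exists (e (s, t)); first by exists (s, t).
by move=> v /=; rewrite eK'; have [->] := gP (s, t).
Qed.

(** * From octahedrality of [H] to the operator [phi] *)

Theorem theorem3p1 (R : realType) (X Y : completeNormedModType R) (K : Type)
    (K_uncountable : ~ countable [set: K])
    (H : set (boundedOp Y X)) (H_subspace : lin_subspace H)
    (finite_rank_H : finite_rank `<=` H) :
  (octahedral K H -> uniformly_convex Y ->
    forall (Z : set X) (W : set Y) (eps : R),
      lin_subspace Z -> dens_lt Z K -> lin_subspace W -> dens_lt W K ->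
      0 < eps ->
    exists phi : boundedOp Y X, [/\ `|phi| <= 1,
      forall z w, Z z -> W w ->
        `|z + phi w| >= (1 - eps) * (`|z| + `|w|) &
      eps < 1 -> forall w, W w ->
        (1 - eps) * `|w| <= `|phi w| <= (1 - eps)^-1 * `|w|])
  /\
  (rigid_octahedral K H ->
    (forall y : Y, `|y| = 1 -> strongly_exposed_point y) ->
    forall (Z : set X) (W : set Y),
      lin_subspace Z -> dens_lt Z K -> lin_subspace W -> dens_lt W K ->
    exists phi : boundedOp Y X, [/\ `|phi| <= 1,
      forall z w, Z z -> W w -> `|z + phi w| = `|z| + `|w| &
      forall w w', W w -> W w' -> `|phi w - phi w'| = `|w - w'|])
  /\
  (locally_uniformly_rotund Y ->
    forall y : Y, `|y| = 1 -> strongly_exposed_point y).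
Proof.
(* Octahedrality applied to the empty collection will supply an operator of norm 1. *)
have K0 : card_lt (set0 : set K) [set: K].
  split=> // K0; apply: K_uncountable; exact: card_le_trans K0 _.
split; last split; last exact: locally_uniformly_rotund_strongly_exposed.
- move=> octH ucY Z W eps /lin_subspace0 Z0 Zd _ Wd eps0.
  have /choice[f fP] : forall y : Y, exists f : boundedOp Y R^o,
      `|y| = 1 -> `|f| = 1 /\ f y = 1.
    move=> y; have [/norming_functional[f fP]|ny] := pselect (`|y| = 1).
      by exists f.
    by exists 0.
  have [|T0 [_ T01 _]] := octH set0 (fun=> 0) K0 _ 1 ltr01; first by [].
  have [|S [S' [a [b [I [x [[a1 b1] aZ bW [IK xH] xab]]]]]]] :=
    unit_rank_one_family K_uncountable finite_rank_H (ex_intro _ T0 T01)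
      Zd Wd (f := f).
    by move=> y /fP[].
  have [d d0 ucd] := uniformly_convex_exposed ucY (divr_gt0 eps0 (ltr0n _ 2)).
  (* The total loss is [2 d' + eps / 2 <= eps]. Octahedrality is used with [d' / 2] because
     [exposed_rank_one] needs a strict inequality. *)
  pose d' := Num.min d (eps / 4).
  have d'0 : 0 < d' by rewrite lt_min d0 divr_gt0.
  have [d'd d'e] : d' <= d /\ d' <= eps / 4 by rewrite !ge_min !lexx orbT.
  have [T [_ T1 xT]] := octH I x IK xH _ (divr_gt0 d'0 (ltr0n _ 2)).
  have Tle1 : `|T| <= 1 by rewrite T1.
  have lb z w : Z z -> W w -> (1 - eps) * (`|z| + `|w|) <= `|z + T w|.
    apply: (span_norm_lower_bound (ltW eps0) Tle1 a1 b1 aZ bW) => s t.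
    have [i Ii xi] := xab s t; have [f1 fb] := fP _ (b1 t).
    have fle1 : `|f (b t)| <= 1 by rewrite f1.
    apply: le_trans
      (exposed_rank_one (d := d') (e := eps / 2) fle1 (a1 s) Tle1 xi _ _).
    + lra.
    + move=> v v1 fv; apply: (ucd _ _ fle1 (b1 t) fb) => //.
      by apply: le_lt_trans fv; rewrite lerB.
    + apply: lt_le_trans (xT i Ii); lra.
  exists T; split=> // eps1 w Ww.
  have Tw : `|T w| <= `|w| by rewrite (le_trans (ler_bounded_op _ _))// T1 mul1r.
  apply/andP; split.
    by have := lb 0 w Z0 Ww; rewrite normr0 !add0r.
  rewrite (le_trans Tw)// ler_peMl// invf_ge1; lra.
- move=> octH expY Z W /lin_subspace0 Z0 Zd Wsub Wd.
  have /choice[f fP] : forall y : Y, exists f : boundedOp Y R^o,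
      `|y| = 1 -> `|f| = 1 /\ forall e : R, 0 < e -> exists2 d : R, 0 < d &
        forall v, `|v| <= 1 -> 1 - d < f v -> `|v - y| <= e.
    move=> y; have [/expY[_ [f [f1 _ fy]]]|ny] := pselect (`|y| = 1).
      by exists f => _; split=> //; apply: strongly_exposed_uniform; rewrite ?f1.
    by exists 0.
  have [|T0 [_ T01 _]] := octH set0 (fun=> 0) K0; first by [].
  have [|S [S' [a [b [I [x [[a1 b1] aZ bW [IK xH] xab]]]]]]] :=
    unit_rank_one_family K_uncountable finite_rank_H (ex_intro _ T0 T01)
      Zd Wd (f := f).
    by move=> y /fP[].
  have [T [_ T1 xT]] := octH I x IK xH.
  have Tle1 : `|T| <= 1 by rewrite T1.
  have isom z w : Z z -> W w -> `|z + T w| = `|z| + `|w|.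
    move=> Zz Ww; apply/eqP; rewrite eq_le; apply/andP; split.
      rewrite (le_trans (ler_normD _ _))// lerD2l (le_trans (ler_bounded_op _ _))//.
      by rewrite T1 mul1r.
    rewrite -[leLHS]mul1r -[X in X * _](subr0 1).
    apply: (span_norm_lower_bound (lexx 0) Tle1 a1 b1 aZ bW) => // s t.
    (* Since [|x i + T|] is exactly 2, both [eps] and the [d] attached to [b t] may be chosen after
       [T]; no uniformity in [t] is required. *)
    rewrite subr0; apply/ler_addgt0Pr => eps eps0.
    have [i Ii xi] := xab s t; have [f1 fb] := fP _ (b1 t).
    have fle1 : `|f (b t)| <= 1 by rewrite f1.
    have [d d0 fd] := fb _ (divr_gt0 eps0 (ltr0n _ 2)).
    pose d' := Num.min d (eps / 4).
    have d'0 : 0 < d' by rewrite lt_min d0 divr_gt0.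
    have [d'd d'e] : d' <= d /\ d' <= eps / 4 by rewrite !ge_min !lexx orbT.
    rewrite -lerBlDr.
    apply: le_trans
      (exposed_rank_one (d := d') (e := eps / 2) fle1 (a1 s) Tle1 xi _ _).
    + lra.
    + move=> v v1 fv; apply: fd => //.
      by apply: le_lt_trans fv; rewrite lerB.
    + rewrite xT//; lra.
  exists T; split=> // w w' Ww Ww'.
  have Wb : W (w - w') by exact: lin_subspaceB.
  have := isom 0 _ Z0 Wb; rewrite !(add0r, normr0) => <-.
  by rewrite (linearB T).
Qed.
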